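(* Let $n\ge 1$, let $u_1,\dots,u_n$ be the standard orthonormal basis of $\mathbb{R}^n$, let $c_{ij}=c_{ji}$ ($1\le i\ne j\le n$) be real edge weights and let $\phi_{ij}\neq0$ ($1\le i\neq j\le n$) be real numbers with $\phi_{ji}=\phi_{ij}^{-1}$ (a line bundle with connection on a graph with vertices $1,\dots,n$). Let $M:\mathbb{R}^n\to\mathbb{R}^n$ be the Laplacian of the bundle, $$M\Bigl(\sum_{i=1}^n v_iu_i\Bigr)=\sum_{1\le i<j\le n}c_{ij}(v_i-\phi_{ji}v_j)(u_i-\phi_{ij}u_j)=\sum_{i=1}^n u_i\sum_{j\ne i}c_{ij}(v_i-\phi_{ji}v_j).$$ Then the characteristic polynomial of $M$ is $\sum_{k=0}^n(-1)^k\mu_kt^{n-k}$, where $$\mu_k=\sum_{F}\ \prod_{(pq)\text{ an edge of }F}c_{pq}\ \prod_{i=1}^{n-k}(m_i+1)\ \prod_{j=1}^{\ell}(1-w_j)(1-1/w_j).$$ Here the sum is over all mixed forests $F$ with vertices $1,\dots,n$ and $k$ edges; such $F$ splits into $n-k$ tree components and some number $\ell=\ell(F)\ge 0$ of one-cycle components; $m_i$ is the number of edges in the $i$-th tree component, and $w_j$ is the holonomy of the cycle in the $j$-th one-cycle component.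
   Context: The characteristic polynomial of $M$ is $\det(t\cdot\mathrm{id}-M)$. Graphs here have no loops and no multiple edges; each edge $\{p,q\}$ can be traversed in both directions, with parallel transport $\phi_{pq}$ from $p$ to $q$ and $\phi_{qp}=\phi_{pq}^{-1}$ from $q$ to $p$. A pair $\{i,j\}$ that is not an edge of the underlying graph is treated as having weight $c_{ij}=0$. A graph $F$ is a mixed forest if each of its connected components is either a tree (possibly a single vertex) or a graph with one cycle (a connected graph whose number of edges equals its number of vertices). The holonomy of a cycle $p_1,p_2,\dots,p_s,p_1$ is $\phi_{p_1p_2}\phi_{p_2p_3}\cdots\phi_{p_sp_1}$; reversing the direction of traversal replaces $w$ by $1/w$, which does not change $(1-w)(1-1/w)$. *)

(* Defs.v *)
From HB Require Import structures.
From mathcomp Require Import all_boot all_order all_algebra.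
From mathcomp Require Import ring.

Set Implicit Arguments.
Unset Strict Implicit.
Unset Printing Implicit Defensive.

Import Order.TTheory GRing.Theory Num.Theory.
Local Open Scope ring_scope.

Section Graphs.

(* A graph without loops or multiple edges on the vertex set 'I_n is given by
   its set of edges, an edge being the two-element set of its endpoints. *)
Variable n : nat.
Implicit Types (F : {set {set 'I_n}}) (C : {set 'I_n}) (s : seq 'I_n).

Definition simple_graph F : bool := [forall e in F, #|e| == 2%N].

Definition adj F : rel 'I_n := [rel p q | [set p; q] \in F].

Definition components F : {set {set 'I_n}} :=
  equivalence_partition (connect (adj F)) [set: 'I_n].

Definition edges_in F C : {set {set 'I_n}} := [set e in F | e \subset C].

(* s = [:: p1; ...; ps] stands for the cycle p1, ..., ps, p1 with a chosen
   starting point and direction. *)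
Definition cycle_in F C s : bool :=
  [&& (2 < size s)%N, ucycleb (adj F) s & all (mem C) s].

(* Bounding the length of s by n loses nothing: a cycle has no repeated
   vertices.  Components are connected, so only acyclicity is required. *)
Definition is_tree F C : bool := [forall s : n.-bseq 'I_n, ~~ cycle_in F C s].

Definition is_one_cycle F C : bool := #|edges_in F C| == #|C|.

Definition mixed_forest F : bool :=
  simple_graph F && [forall C in components F, is_tree F C || is_one_cycle F C].

Definition tree_components F : {set {set 'I_n}} :=
  [set C in components F | is_tree F C].

Definition one_cycle_components F : {set {set 'I_n}} :=
  [set C in components F | is_one_cycle F C].

End Graphs.

Section LineBundle.

Variables (R : realFieldType) (n : nat).
(* Only the off-diagonal values of c and phi are ever used. *)
Variables c phi : 'I_n -> 'I_n -> R.

Definition u (i : 'I_n) : 'rV[R]_n := delta_mx 0 i.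

Definition laplacian (v : 'rV[R]_n) : 'rV[R]_n :=
  \sum_(i < n) \sum_(j < n | (i < j)%N)
    (c i j * (v 0 i - phi j i * v 0 j)) *: (u i - phi i j *: u j).

Fact laplacian_is_linear : linear laplacian.
Proof.
move=> a v w; rewrite /laplacian scaler_sumr -big_split; apply: eq_bigr => i _.
rewrite scaler_sumr -big_split; apply: eq_bigr => j _ /=.
by rewrite !mxE scalerA -scalerDl; congr (_ *: _); ring.
Qed.

HB.instance Definition _ :=
  GRing.isLinear.Build R 'rV[R]_n 'rV[R]_n _ laplacian laplacian_is_linear.

(* Meaningful when s has no repeated vertices, as is the case for cycles. *)
Definition holonomy (s : seq 'I_n) : R := \prod_(p <- s) phi p (next s p).

(* w F C stands for the holonomy of the cycle in the component C of F. *)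
Definition mu (w : {set {set 'I_n}} -> {set 'I_n} -> R) (k : nat) : R :=
  \sum_(F : {set {set 'I_n}} | mixed_forest F && (#|F| == k))
    (\prod_(p < n) \prod_(q < n | (p < q)%N && ([set p; q] \in F)) c p q) *
    (\prod_(C in tree_components F) (#|edges_in F C| + 1)%:R) *
    (\prod_(C in one_cycle_components F) ((1 - w F C) * (1 - 1 / w F C))).

End LineBundle.

(* Main.v *)
Require Import Defs.
From mathcomp Require Import all_boot all_order all_algebra all_fingroup.
From mathcomp Require Import ring zify.

(** Row [i] of [t - M] is a sum of [t e_i] and of the vectors
    [- c_ij (e_i - phi_ij e_j)] for [j != i].  Expanding the determinant by
    multilinearity in the rows lets each vertex [i] either keep [t e_i] or choose
    a neighbour [j = f i] ([char_poly_laplacian]); a choice [f] contributes a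
    power of [t], a product of weights [- c_ij], and the determinant of the
    identity minus the transport along [f].  The latter is the product, over the
    cycles of [f], of [1 - w] with [w] the holonomy: it is multiplicative
    ([det_fun_mx_split]), equal to 1 without cycles ([det_fun_mx_acyclic]) and to
    [1 - w] on a single cycle ([det_fun_mx_next]).

    A choice going back and forth along an edge has a cycle with [w = 1] and
    contributes zero.  In any other choice distinct vertices choose distinct
    edges, so it is an orientation of the chosen edge set [F] with out-degree at
    most one.  Grouping by [F], it remains to sum the determinants over the
    orientations of [F], and this sum is a product over the components of [F]
    ([orientation_sum_components]):
    - a tree with [m] edges is oriented towards an arbitrary root, in [m + 1]
      ways, each contributing 1 ([orientation_sum_tree]);
    - in a one-cycle component everything flows towards the cycle, which runs in
      one of two directions: [(1 - w) + (1 - 1/w) = (1 - w)(1 - 1/w)]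
      ([orientation_sum_cycle]);
    - a component with more edges than vertices has no such orientation
      ([orientation_sum_overfull]).
    So exactly the mixed forests contribute.  That a flow towards a root or a
    cycle exists is a growth argument ([extend_orientation]); that there is no
    other orientation, up to the direction of the cycle, holds because a
    disagreement between two orientations propagates downstream
    ([orients_disagree], [orients_unique]). *)

Set Implicit Arguments.
Unset Strict Implicit.
Unset Printing Implicit Defensive.

Import Order.TTheory GRing.Theory Num.Theory.
Local Open Scope ring_scope.

(** * The matrix of a partial transport map *)

Section FunctionalMatrix.

Variable n : nat.
Implicit Types (f : 'I_n -> 'I_n) (A : {set 'I_n}) (s : seq 'I_n).

Definition restrict f A : {ffun 'I_n -> 'I_n} :=
  [ffun i => if i \in A then f i else i].

Section AnyRing.

Variable R : comNzRingType.
Implicit Types a : 'I_n -> 'I_n -> R.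

(** The identity minus the transport along [f]: row [i] is
    [e_i - a i (f i) e_(f i)] when [f] moves [i], and [e_i] otherwise.  A fixed
    point of [f] stands for a vertex at which no edge has been chosen. *)
Definition fun_mx a f : 'M[R]_n :=
  \matrix_(i, k) ((i == k)%:R - (f i != i)%:R * a i (f i) * (f i == k)%:R).

Lemma eq_fun_mx a f g : f =1 g -> fun_mx a f = fun_mx a g.
Proof. by move=> fg; apply/matrixP => i k; rewrite !mxE fg. Qed.

Lemma sum_delta (l : 'I_n) (X : 'I_n -> R) : \sum_j (l == j)%:R * X j = X l.
Proof.
rewrite (bigD1 l) //= eqxx mul1r big1 ?addr0 // => j jl.
by rewrite eq_sym (negPf jl) mul0r.
Qed.

Lemma det_row_sum (B : 'I_n -> 'I_n -> 'I_n -> R) :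
  \det (\matrix_(i, k) \sum_j B i j k) =
  \sum_(f : {ffun 'I_n -> 'I_n}) \det (\matrix_(i, k) B i (f i) k).
Proof.
rewrite /determinant exchange_big; apply: eq_bigr => p _.
rewrite -big_distrr /=; congr (_ * _).
under eq_bigr => i _ do rewrite mxE.
rewrite bigA_distr_bigA; apply: eq_bigr => f _.
by apply: eq_bigr => i _; rewrite mxE.
Qed.

Lemma det_scale_rows (r : 'I_n -> R) (A : 'M[R]_n) :
  \det (\matrix_(i, k) (r i * A i k)) = (\prod_i r i) * \det A.
Proof.
have -> : \matrix_(i, k) (r i * A i k) = diag_mx (\row_i r i) *m A.
  by apply/matrixP => i k; rewrite mul_diag_mx !mxE.
by rewrite det_mulmx det_diag; congr (_ * _); apply: eq_bigr => i _; rewrite mxE.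
Qed.

(** Writing the two factors as [1 - P] and [1 - Q], the cross term [P Q] vanishes:
    [P] leads from [A] into [A], where [Q] has no rows.  Hence [1 - P - Q] is the
    product, although [f] may lead from outside [A] into [A]. *)
Lemma fun_mx_split a f A : (forall i, i \in A -> f i \in A) ->
  fun_mx a f = fun_mx a (restrict f A) *m fun_mx a (restrict f (~: A)).
Proof.
move=> fA; apply/matrixP => i k; rewrite [RHS]mxE.
under eq_bigr => j _ do rewrite [fun_mx _ _ i j]mxE mulrBl -[_ * _ * _ * _]mulrA.
rewrite sumrB -big_distrr /= !sum_delta !mxE !ffunE !in_setC; case: (boolP (i \in A)) => iA /=.
  by rewrite fA //= !eqxx /= !mul0r !subr0.
by rewrite (negPf iA) /= eqxx !mul0r subr0.
Qed.

Lemma det_fun_mx_split a f A : (forall i, i \in A -> f i \in A) ->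
  \det (fun_mx a f) =
  \det (fun_mx a (restrict f A)) * \det (fun_mx a (restrict f (~: A))).
Proof. by move=> fA; rewrite (fun_mx_split a fA) det_mulmx. Qed.

Lemma det_fun_mx_support a f (p : 'S_n) :
  \prod_i fun_mx a f i (p i) != 0 -> forall i, p i = i \/ p i = f i /\ f i != i.
Proof.
move=> nz i; case: (eqVneq (p i) i) => [|pi]; [by left | right].
have : fun_mx a f i (p i) != 0.
  by apply: contraNneq nz => z; rewrite (bigD1 i) //= z mul0r.
rewrite mxE [i == _]eq_sym (negPf pi) sub0r oppr_eq0.
by case: (eqVneq (f i) (p i)) => [->|]; rewrite ?pi ?mulr0 ?eqxx.
Qed.

(** A permutation contributing to the determinant sends each [i] to [i] or to
    [f i], so it never increases the rank [d]; as it preserves the sum of all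
    ranks, it preserves each of them and must be the identity. *)
Lemma det_fun_mx_acyclic a f (d : 'I_n -> nat) :
  (forall i, f i != i -> (d (f i) < d i)%N) -> \det (fun_mx a f) = 1.
Proof.
move=> dec; rewrite /determinant (bigD1 1%g) //= [X in _ + X]big1 => [|p p1].
  rewrite odd_perm1 expr0 mul1r addr0 big1 // => i _.
  rewrite mxE perm1 eqxx; case: (eqVneq (f i) i) => _; rewrite ?mul0r ?mulr0 ?mul0r subr0 //.
apply/eqP; apply: contraNT p1 => nz; apply/eqP/permP => i; rewrite perm1.
have supp := @det_fun_mx_support a f p.
have {}supp : forall i, p i = i \/ p i = f i /\ f i != i.
  by apply: supp; apply: contraNneq nz => ->; rewrite mulr0.
have le_d j : (d (p j) <= d j)%N.
  by case: (supp j) => [->|[-> /dec/ltnW]].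
have /eqP : (\sum_j d (p j) = \sum_j d j)%N.
  by rewrite [RHS](reindex_inj (@perm_inj _ p)).
rewrite (leqif_sum (fun j _ => leqif_eq (le_d j))) => /forallP/(_ i)/eqP eq_d.
by case: (supp i) => // -[pE /dec]; rewrite -pE eq_d ltnn.
Qed.

End AnyRing.

Lemma next_neq s x : uniq s -> (1 < size s)%N -> x \in s -> next s x != x.
Proof.
move=> us ss xs; case: (rot_to xs) => k s' E.
rewrite -(next_rot k us) E; have : uniq (x :: s') by rewrite -E rot_uniq.
have : (1 < size (x :: s'))%N by rewrite -E size_rot.
by case: s' {E} => //= y s' _ /andP[]; rewrite inE eqxx negb_or eq_sym => /andP[].
Qed.

Lemma next_next_neq s x :
  uniq s -> (2 < size s)%N -> x \in s -> next s (next s x) != x.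
Proof.
move=> us ss xs; case: (rot_to xs) => k s' E.
rewrite -!(next_rot k us) E; have : uniq (x :: s') by rewrite -E rot_uniq.
have : (2 < size (x :: s'))%N by rewrite -E size_rot.
case: s' {E} => [|y [|z s']] //= _ /andP[]; rewrite !inE !negb_or.
move=> /and3P[xy xz _] _; rewrite eqxx [y == x]eq_sym (negPf xy) eqxx.
by rewrite eq_sym.
Qed.

Lemma next_id s x : x \notin s -> next s x = x.
Proof. by move=> xs; rewrite next_nth (negPf xs). Qed.

Lemma next_transitive s (P : pred 'I_n) x y : uniq s ->
  x \in s -> y \in s -> P x -> (forall z, z \in s -> P z -> P (next s z)) -> P y.
Proof.
move=> us xs ys Px Pn.
have := ys; rewrite -(fconnect_cycle (cycle_next us) xs) => /iter_findex <-.
set k := findex _ _ _; set z := iter _ _ _.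
suff : z \in s /\ P z by case.
by rewrite {}/z; elim: k => //= k [ks Pk]; rewrite mem_next; split; last exact: Pn.
Qed.

(** Only the identity and the cycle itself contribute: a contributing permutation
    that moves one vertex of the cycle along it must, being injective, move the
    next one as well.  The sign of the cycle is left unevaluated as part of [e]. *)
Lemma det_fun_mx_next_sign (R : comNzRingType) s : uniq s -> (1 < size s)%N ->
  exists e : R, forall a,
    \det (fun_mx a (next s)) = 1 + e * \prod_(p <- s) a p (next s p).
Proof.
move=> us ss; pose c := perm (can_inj (prev_next us)).
exists ((-1) ^+ c * \prod_(p in s) -1) => a.
have [x xs] : exists x, x \in s.
  by case: s ss {us c} => // x s; exists x; rewrite mem_head.
have c1 : c != 1%g.
  by apply/eqP => /permP/(_ x)/eqP; rewrite permE perm1 (negPf (next_neq us ss xs)).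
rewrite /determinant (bigD1 1%g) //= (bigD1 c) //= addrA [X in _ + X]big1 => [|p /andP[p1 pc]].
  rewrite addr0 odd_perm1 expr0 mul1r; congr (_ + _).
    rewrite big1 // => i _; rewrite mxE perm1 eqxx.
    by case: (eqVneq (next s i) i) => _; rewrite ?mul0r ?mulr0 subr0.
  rewrite -mulrA; congr (_ * _).
  rewrite [\prod_(p <- s) _]big_uniq //= -big_split /= (bigID (mem s)) /= mulrC big1 ?mul1r.
    apply: eq_bigr => i si; rewrite mxE permE eq_sym (negPf (next_neq us ss si)).
    by rewrite eqxx mul1r mulr1 sub0r mulN1r.
  by move=> i si; rewrite mxE permE next_id // eqxx mul0r mul0r subr0.
apply/eqP; apply: contraNT pc => nz.
have supp : forall i, p i = i \/ p i = next s i /\ next s i != i.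
  by apply: (@det_fun_mx_support _ a); apply: contraNneq nz => ->; rewrite mulr0.
have [y py] : exists y, p y != y.
  apply/existsP; apply: contraNT p1; rewrite negb_exists => /forallP id_p.
  by apply/eqP/permP => i; rewrite perm1; apply/eqP/negbNE/id_p.
have nextP z : p z != z -> p z = next s z by case: (supp z) => [->|[]]; rewrite ?eqxx.
have ys : y \in s by apply: contraNT py => /next_id ny; case: (supp y) => [->|[-> _]]; rewrite ?ny.
apply/eqP/permP => i; rewrite permE.
case: (boolP (i \in s)) => [si|/[dup] /next_id ni]; last first.
  by case: (supp i) => [->|[]] //; rewrite ni.
apply: (nextP); apply: (@next_transitive s (fun z => p z != z) y i us ys si py) => z zs pz.
(* injectivity of p forces the next vertex to move as soon as this one does *)
by rewrite -(nextP _ pz) (inj_eq perm_inj).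
Qed.

(** The sign in [det_fun_mx_next_sign] does not depend on [a], and it is found by
    taking [a] constant equal to 1: the indicator of the cycle is then in the
    kernel, so the determinant vanishes. *)
Lemma det_fun_mx_next (R : comNzRingType) (a : 'I_n -> 'I_n -> R) s :
  uniq s -> (1 < size s)%N ->
  \det (fun_mx a (next s)) = 1 - \prod_(p <- s) a p (next s p).
Proof.
move=> us ss; have [e De] := det_fun_mx_next_sign R us ss.
suff e1 : e = -1 by rewrite De e1 mulN1r.
have := De (fun _ _ => 1); rewrite big1 // mulr1.
set A := fun_mx _ _ => detA; pose v : 'cV[R]_n := \col_i (i \in s)%:R.
have Av : A *m v = 0.
  apply/colP => i; rewrite !mxE.
  under eq_bigr => j _ do rewrite !mxE mulr1 mulrBl.
  rewrite sumrB sum_delta; under eq_bigr => j _ do rewrite -mulrA.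
  rewrite -big_distrr /= sum_delta mem_next.
  case: (boolP (i \in s)) => si; last by rewrite mulr0 subr0.
  by rewrite next_neq // mul1r subrr.
have [x xs] : exists x, x \in s.
  by case: s ss {us De A v detA Av} => // x s; exists x; rewrite mem_head.
have : \adj A *m (A *m v) = 0 by rewrite Av mulmx0.
rewrite mulmxA mul_adj_mx mul_scalar_mx detA => /colP/(_ x).
rewrite !mxE xs mulr1 => /eqP; rewrite addrC addr_eq0 => /eqP //.
Qed.

End FunctionalMatrix.

(** * Orientations of a set of edges *)

Section Orientations.

Variable n : nat.
Implicit Types (f g h b : 'I_n -> 'I_n) (F : {set {set 'I_n}}) (A C S : {set 'I_n}).

Definition moved f : {set 'I_n} := [set i | f i != i].

Definition arcs f : {set {set 'I_n}} := [set [set i; f i] | i in moved f].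

Lemma mem_arcs f x : x \in moved f -> [set x; f x] \in arcs f.
Proof. exact: imset_f. Qed.

(** Each moved vertex [i] is the tail of the edge [{i, f i}]; the second condition
    makes distinct vertices choose distinct edges, so that [f] amounts to an
    orientation of all the edges of [F] with out-degree at most one. *)
Definition orients f F : bool :=
  (arcs f == F) && [forall i in moved f, f (f i) != i].

Lemma eq_set2 (x y z t : 'I_n) :
  [set x; y] = [set z; t] -> x = z /\ y = t \/ x = t /\ y = z.
Proof.
move=> E; have := set21 x y; have := set22 x y; have := set21 z t; have := set22 z t.
rewrite {1 2}E -{1 2}E !inE.
by do 4![case/orP => /eqP ?]; subst; auto.
Qed.

Lemma arc_inj f : (forall i, i \in moved f -> f (f i) != i) ->
  {in moved f &, injective (fun i => [set i; f i])}.
Proof.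
move=> ff i j i_m _ /eq_set2[[]|[ij fij]] //.
by move: (ff i i_m); rewrite fij -ij eqxx.
Qed.

Lemma card_arcs f : (forall i, i \in moved f -> f (f i) != i) ->
  #|arcs f| = #|moved f|.
Proof. by move=> /arc_inj; apply: card_in_imset. Qed.

Lemma orientsP f F :
  reflect (arcs f = F /\ forall i, i \in moved f -> f (f i) != i) (orients f F).
Proof.
apply: (iffP andP) => -[/eqP fF ff]; split=> //; first exact/forall_inP.
exact/forall_inP.
Qed.

Lemma orients_card f F : orients f F -> #|F| = #|moved f|.
Proof. by case/orientsP => <-; apply: card_arcs. Qed.

Lemma orients_moved f F i : orients f F -> f i != i -> [set i; f i] \in F.
Proof. by move=> /orientsP[<- _] fi; apply: imset_f; rewrite inE. Qed.

(** The edge [{x, f x}] is also chosen by [g], necessarily from its other end;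
    so the disagreement moves along [f] and [g] goes backwards. *)
Lemma orients_disagree f g F x : orients f F -> orients g F ->
  moved f = moved g -> f x != g x -> g (f x) = x /\ f (f x) != g (f x).
Proof.
move=> /orientsP[fF ff] /orientsP[gF gg] fg fgx.
have fx : x \in moved f.
  apply: contraNT fgx => /[dup]; rewrite {2}fg !inE !negbK => /eqP -> /eqP ->.
  exact: eqxx.
have /imsetP[z zg /eq_set2 E] : [set x; f x] \in arcs g by rewrite gF -fF; apply: imset_f.
suff gfx : g (f x) = x by rewrite gfx; split; last exact: ff.
by case: E fgx => -[xz fxz]; rewrite fxz -?xz ?eqxx.
Qed.

(** Disagreement propagates along [g], which strictly decreases [d] outside [S]: a
    disagreement of least rank cannot exist. *)
Lemma orients_unique f g F S (d : 'I_n -> nat) :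
  orients f F -> orients g F -> moved f = moved g -> {in S, f =1 g} ->
  (forall x, x \notin S -> x \in moved g -> (d (g x) < d x)%N) -> f =1 g.
Proof.
move=> fF gF fg eqS dec x; apply/eqP; apply: contraT => fgx.
have [y fgy y_min] := @arg_minnP _ x (fun y => f y != g y) d fgx.
have yS : y \notin S by apply: contra fgy => /eqS ->.
have yg : y \in moved g.
  apply: contraNT fgy => /[dup]; rewrite -{1}fg !inE !negbK => /eqP -> /eqP ->.
  exact: eqxx.
have [|_ fgg] := orients_disagree gF fF (esym fg) (x := y); first by rewrite eq_sym.
have := y_min (g y); rewrite eq_sym => /(_ fgg); rewrite leqNgt => /negP[].
exact: dec.
Qed.

(** No nonempty proper part of [C] is cut off from the rest of [C].  This form of
    connectedness lets a set of vertices grow inside [C] one vertex at a time. *)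
Definition connected_on F C := forall A, A \subset C -> A != set0 -> A != C ->
  exists x y, [/\ x \in C :\: A, y \in A & [set x; y] \in F].

(** The set [S] grows to [C] one vertex at a time; each new vertex points to an
    earlier one, and [d] records the order of arrival. *)
Lemma connected_on_descent F C S : connected_on F C -> S \subset C -> S != set0 ->
  exists b (d : 'I_n -> nat), forall x, x \in C :\: S ->
    [/\ b x \in C, [set x; b x] \in F & (d (b x) < d x)%N].
Proof.
move=> conn; have [k] := ubnP #|C :\: S|; elim: k S => // k IH S ltk SC S0.
have [->|SnC] := eqVneq S C.
  by exists id, (fun=> 0%N) => x; rewrite setDv inE.
have [x [y [xCS yS xyF]]] := conn S SC S0 SnC.
have [xS xC] : x \notin S /\ x \in C by move: xCS; rewrite inE => /andP.
have [|||b [d bd]] := IH (x |: S).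
- rewrite ltnS in ltk; apply: leq_trans ltk; apply: proper_card.
  rewrite setDUr; apply/properP; split; first exact: subsetIr.
  by exists x => //; rewrite !inE eqxx.
- by rewrite subUset sub1set xC.
- by rewrite -card_gt0 (cardsD1 x) !inE eqxx.
exists (fun z => if z == x then y else b z).
exists (fun z => if z \in S then 0%N else if z == x then 1%N else (d z).+2).
move=> z zCS; have [zS zC] : z \notin S /\ z \in C by move: zCS; rewrite inE => /andP.
rewrite (negPf zS); have [->|zx] := eqVneq z x.
  by rewrite yS; split=> //; apply: (subsetP SC).
have [|bC bF bdz] := bd z; first by rewrite !inE negb_or zx zS.
by split=> //; case: ifP => // _; case: ifP.
Qed.

(** An orientation [h] given on [S] extends to [C] by letting all the other
    vertices of [C] flow towards [S].  It is used with [S] a single root and with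
    [S] the set of vertices of a cycle. *)
Lemma extend_orientation F C S h : connected_on F C -> S \subset C -> S != set0 ->
  (forall x, x \in S -> h x \in S) ->
  (forall x, x \in S -> h x != x -> [set x; h x] \in F /\ h (h x) != x) ->
  exists (g : {ffun 'I_n -> 'I_n}) (d : 'I_n -> nat),
  [/\ {in S, g =1 h},
      forall x, x \in C :\: S -> g x \in C /\ (d (g x) < d x)%N,
      moved g = (C :\: S) :|: [set x in S | h x != x],
      arcs g \subset edges_in F C
    & forall i, i \in moved g -> g (g i) != i].
Proof.
move=> conn SC S0 hS hF; have [b [d bd]] := connected_on_descent conn SC S0.
pose g : {ffun 'I_n -> 'I_n} :=
  [ffun x => if x \in S then h x else if x \in C then b x else x].
have gS x : x \in S -> g x = h x by move=> xS; rewrite ffunE xS.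
have gC x : x \in C :\: S -> g x = b x.
  by rewrite inE ffunE => /andP[/negPf -> ->].
have bN x : x \in C :\: S -> b x != x.
  by move=> /bd[_ _]; apply: contraTneq => ->; rewrite ltnn.
have gM : moved g = (C :\: S) :|: [set x in S | h x != x].
  apply/setP => x; rewrite !inE ffunE; have := bN x; rewrite inE.
  by case: (x \in S) => //= ; case: (x \in C) => //= [->|]; rewrite ?eqxx.
exists g, d; split=> //.
- by move=> x xCS; rewrite gC //; have [] := bd x xCS.
- apply/subsetP => _ /imsetP[x xg ->]; rewrite !inE subUset !sub1set.
  move: xg; rewrite gM !inE; case: (boolP (x \in S)) => xS /=.
    move=> hx; rewrite gS // (subsetP SC) //= (subsetP SC) ?hS // andbT.
    by have [] := hF x xS hx.
  rewrite orbF => xC; have xCS : x \in C :\: S by rewrite inE xS.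
  by have [bC bF _] := bd x xCS; rewrite gC // xC bC bF.
move=> x; rewrite gM inE => /orP[xCS|]; last first.
  by rewrite inE => /andP[xS hx]; rewrite !gS ?hS //; have [] := hF x xS hx.
have [bC bF db] := bd x xCS; rewrite (gC x) //.
have [bS|bS] := boolP (b x \in S).
  rewrite gS //; apply: contraTneq xCS => hbx; rewrite inE -hbx hS //.
have bCS : b x \in C :\: S by rewrite inE bS.
rewrite gC //; have [_ _ db'] := bd _ bCS.
by apply: contraTneq (ltn_trans db' db) => ->; rewrite ltnn.
Qed.

End Orientations.

(** * Components: trees, cycles and edge counts *)

Section Components.

Variable n : nat.
Implicit Types (F : {set {set 'I_n}}) (A C : {set 'I_n}) (s : seq 'I_n).

Lemma connect_adj_sym F : connect_sym (adj F).
Proof. by apply: sym_connect_sym => x y; rewrite /adj /= setUC. Qed.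

Lemma connect_adj_equiv F :
  {in [set: 'I_n] & &, equivalence_rel (connect (adj F))}.
Proof.
move=> x y z _ _ _; split=> [|xy]; first exact: connect0.
by apply: (same_connect (@connect_adj_sym F)).
Qed.

Lemma components_partition F : partition (components F) [set: 'I_n].
Proof. exact: equivalence_partitionP (@connect_adj_equiv F). Qed.

Lemma componentE F C x : C \in components F -> x \in C ->
  C = [set y | connect (adj F) x y].
Proof.
move=> CF xC; have /and3P[_ tI _] := components_partition F.
apply/setP => y; rewrite inE -{1}(def_pblock tI CF xC).
by rewrite (pblock_equivalence_partition (@connect_adj_equiv F)) ?inE.
Qed.

Lemma component_neq0 F C : C \in components F -> C != set0.
Proof.
by move=> CF; have /and3P[_ _] := components_partition F; apply: contraNneq => <-.
Qed.

Lemma component_connected F C : C \in components F -> connected_on F C.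
Proof.
move=> CF A AC /set0Pn[y yA] AnC.
have [x xCA] : exists x, x \in C :\: A.
  by apply/set0Pn; rewrite setD_eq0; apply: contraNN AnC => CA; rewrite eqEsubset AC.
have [xA xC] : x \notin A /\ x \in C by move: xCA; rewrite inE => /andP.
pose leaves (z t : 'I_n) := [&& z \in C :\: A, t \in A & [set z; t] \in F].
have [/existsP[z /existsP[t /and3P[]]]|none] := boolP [exists z, exists t, leaves z t].
  by exists z, t.
have closedA : closed (adj F) A.
  apply: (intro_closed (@connect_adj_sym F)) => z t zt zA.
  apply: contraNT none => tA; apply/existsP; exists t; apply/existsP; exists z.
  rewrite /leaves zA setUC [_ \in F]zt !andbT inE tA (componentE CF xC) inE.
  move: (subsetP AC z zA); rewrite (componentE CF xC) inE => xz.
  exact: connect_trans xz (connect1 zt).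
move: (subsetP AC y yA); rewrite {1}(componentE CF xC) inE.
by move=> /(closed_connect closedA); rewrite (negPf xA) yA.
Qed.

Lemma edges_in_set2 F C x y :
  [set x; y] \in edges_in F C = [&& [set x; y] \in F, x \in C & y \in C].
Proof. by rewrite inE subUset !sub1set. Qed.

Lemma subset_orients f F C : orients f (edges_in F C) -> moved f \subset C.
Proof.
move=> fF; apply/subsetP => x; rewrite inE => /(orients_moved fF).
by rewrite edges_in_set2 => /and3P[].
Qed.

Lemma spanning_tree F C r : connected_on F C -> r \in C ->
  exists (g : {ffun 'I_n -> 'I_n}) (d : 'I_n -> nat),
  [/\ moved g = C :\ r, forall x, x \in moved g -> (d (g x) < d x)%N,
      arcs g \subset edges_in F C
    & forall i, i \in moved g -> g (g i) != i].
Proof.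
move=> conn rC.
have [||x|x|g [d [gr gd gM gF gg]]] := @extend_orientation n F C [set r] id conn.
- by rewrite sub1set.
- by apply/set0Pn; exists r; rewrite inE.
- by [].
- by rewrite eqxx.
have {}gM : moved g = C :\ r.
  by rewrite gM; apply/setP => x; rewrite !inE eqxx andbF orbF.
by exists g, d; split=> // x; rewrite gM => /gd[].
Qed.

Lemma card_spanning_tree F C : C != set0 -> connected_on F C ->
  (#|C| <= #|edges_in F C|.+1)%N.
Proof.
move=> /set0Pn[r rC] conn; have [g [d [gM _ gF gg]]] := spanning_tree conn rC.
by rewrite (cardsD1 r) rC -gM -card_arcs // ltnS subset_leq_card.
Qed.

(** A path without repetition from [x] to [y] that avoids the edge [{x, y}] has at
    least three vertices, and that edge closes it into a cycle. *)
Lemma connect_closes_cycle F C x y : C \in components F ->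
  x != y -> x \in C -> [set x; y] \in F -> connect (adj (F :\ [set x; y])) x y ->
  exists s, cycle_in F C s.
Proof.
move=> CF xy xC xyF /connectP[p0 p0P yE].
case/shortenP: p0P yE => p pP up _ yE; exists (x :: p).
have subF : path (adj F) x p.
  by apply: sub_path pP => z t; rewrite /adj /= in_setD1 => /andP[].
apply/and3P; split.
- case: p {up subF} pP yE => [|z [|z' p]] //=; first by move=> _ yx; rewrite yx eqxx in xy.
  by rewrite /adj /= andbT in_setD1 => /andP[] xz _ yz; rewrite yz eqxx in xz.
- by rewrite /ucycleb up andbT /= rcons_path subF /= /adj /= -yE setUC.
apply/allP => z zp; rewrite inE (componentE CF xC) inE.
exact: path_connect subF _ zp.
Qed.

(** A spanning tree uses one edge fewer than there are vertices, so some edge is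
    left over; the tree already joins its endpoints. *)
Lemma cycle_exists F C : simple_graph F -> C \in components F ->
  (#|C| <= #|edges_in F C|)%N -> exists s, cycle_in F C s.
Proof.
move=> simpleF CF leCE; have conn := component_connected CF.
have /set0Pn[r rC] := component_neq0 CF.
have [g [d [gM gd gF gg]]] := spanning_tree conn rC.
have [e eF eg] : exists2 e, e \in edges_in F C & e \notin arcs g.
  apply/subsetPn; apply: contraTN leCE => /subset_leq_card.
  by rewrite (card_arcs gg) gM (cardsD1 r C) rC -ltnNge.
have [eFF eC] : e \in F /\ e \subset C by move: eF; rewrite inE => /andP.
have /cards2P[x [y [xy eE]]] := forall_inP simpleF e eFF.
have to_root k z : (d z < k)%N -> z \in C -> connect (adj (F :\ e)) z r.
  elim: k z => // k IH z dz zC; have [->|zr] := eqVneq z r; first exact: connect0.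
  have zg : z \in moved g by rewrite gM !inE zr.
  have zgA : [set z; g z] \in arcs g by apply: imset_f.
  have := subsetP gF _ zgA; rewrite edges_in_set2 => /and3P[zgF _ gzC].
  apply: connect_trans (IH (g z) _ gzC); last first.
    exact: leq_trans (gd z zg) dz.
  apply: connect1; rewrite /adj /= in_setD1 zgF andbT.
  by apply: contraNneq eg => <-.
have [xC yC] : x \in C /\ y \in C.
  by move: eC; rewrite eE subUset !sub1set => /andP.
apply: (connect_closes_cycle CF xy xC); first by rewrite -eE.
rewrite -eE; apply: connect_trans (to_root _ _ (ltnSn _) xC) _.
rewrite connect_adj_sym; exact: to_root (ltnSn _) yC.
Qed.

Lemma cycle_orientation F C s : connected_on F C -> cycle_in F C s ->
  exists (g : {ffun 'I_n -> 'I_n}) (d : 'I_n -> nat),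
  [/\ {in s, g =1 next s},
      forall x, x \in C -> x \notin s -> (d (g x) < d x)%N,
      moved g = C, arcs g \subset edges_in F C
    & forall i, i \in moved g -> g (g i) != i].
Proof.
move=> conn /and3P[size_s /andP[cyc us] sC].
have subC : [set x in s] \subset C.
  by apply/subsetP => x; rewrite inE => /(allP sC).
have [|x|x|g [d [gs gd gM gF gg]]] :=
  @extend_orientation n F C [set x in s] (next s) conn subC.
- case: s size_s {cyc us sC subC} => // x s _.
  by apply/set0Pn; exists x; rewrite inE mem_head.
- by rewrite !inE mem_next.
- rewrite inE => xs _; split; last exact: next_next_neq.
  exact: (next_cycle cyc xs).
have {}gM : moved g = C.
  rewrite gM; apply/setP => x; rewrite !inE; have := subsetP subC x; rewrite inE.
  case: (boolP (x \in s)) => /= [xs ->//|_ _]; last by rewrite orbF.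
  by rewrite next_neq // ltnW.
exists g, d; split=> // [x xs|x xC xs]; first by apply: gs; rewrite inE.
by have [|_ //] := gd x; rewrite !inE xs.
Qed.

(** Orient the cycle and let the rest of [C] flow towards it: every vertex then
    chooses an edge of its own. *)
Lemma cycle_card F C s : connected_on F C -> cycle_in F C s ->
  (#|C| <= #|edges_in F C|)%N.
Proof.
move=> conn cyc; have [g [d [_ _ gM gF gg]]] := cycle_orientation conn cyc.
have <- : #|arcs g| = #|C| by rewrite card_arcs // gM.
exact: subset_leq_card.
Qed.

(** In a component the number of edges is at least the number of vertices minus
    one, and there is a cycle exactly when it is larger than that. *)
Lemma is_treeE F C : simple_graph F -> C \in components F ->
  is_tree F C = (#|C| == #|edges_in F C|.+1).
Proof.
move=> simpleF CF; have conn := component_connected CF.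
rewrite eqn_leq (card_spanning_tree (component_neq0 CF) conn) /= ltnNge.
apply/forallP/idP => [acyc|ltEC s].
  apply/negP => /(cycle_exists simpleF CF)[s cyc].
  have us : uniq s by case/and3P: cyc => _ /andP[].
  have size_s : (size s <= n)%N.
    by rewrite -(card_uniqP us) -[X in (_ <= X)%N]card_ord max_card.
  by have := acyc (Bseq size_s); rewrite cyc.
by apply: contra ltEC => /(cycle_card conn).
Qed.

End Components.

(** * The sum of the determinants over all orientations *)

Section OrientationSum.

Variable n : nat.
Implicit Types (F : {set {set 'I_n}}) (A C : {set 'I_n}) (s : seq 'I_n).

Definition edges_split F A := forall e, e \in F -> e \subset A \/ e \subset ~: A.

Lemma simple_edge_component F C : simple_graph F -> C \in components F ->
  edges_split F C.
Proof.
move=> simpleF CF e eF; have /cards2P[x [y [_ eE]]] := forall_inP simpleF e eF.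
have adj_in z t : [set z; t] \in F -> z \in C -> t \in C.
  by move=> zt zC; rewrite (componentE CF zC) inE; apply: connect1.
rewrite eE !subUset !sub1set !inE; move: eF; rewrite eE => eF.
case: (boolP (x \in C)) => xC; [left; exact: adj_in eF xC | right].
by apply: contraNN xC; apply: adj_in; rewrite setUC.
Qed.

Lemma moved_restrict (f : 'I_n -> 'I_n) A : moved (restrict f A) = moved f :&: A.
Proof.
by apply/setP => x; rewrite !inE ffunE; case: ifP; rewrite ?andbT ?andbF ?eqxx.
Qed.

Lemma arcs_restrict (f : 'I_n -> 'I_n) A : {in A, forall x, f x \in A} ->
  arcs (restrict f A) = edges_in (arcs f) A.
Proof.
move=> fA; apply/setP => e; rewrite inE; apply/imsetP/andP => [[x]|[]].
  rewrite moved_restrict inE => /andP[xf xA] ->; rewrite ffunE xA.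
  by rewrite mem_arcs // subUset !sub1set xA fA.
move=> /imsetP[x xf ->]; rewrite subUset !sub1set => /andP[xA _].
exists x; last by rewrite ffunE xA.
by rewrite moved_restrict inE xf xA.
Qed.

Lemma orients_split (f : 'I_n -> 'I_n) F A : edges_split F A ->
  orients f F = orients (restrict f A) (edges_in F A) &&
                orients (restrict f (~: A)) (edges_in F (~: A)).
Proof.
move=> spl.
have closed_restrict (B : {set 'I_n}) : orients (restrict f B) (edges_in F B) ->
    {in B, forall x, f x \in B}.
  move=> fB x xB; have [->//|fx] := eqVneq (f x) x.
  have := @orients_moved _ _ _ x fB; rewrite ffunE xB => /(_ fx).
  by rewrite edges_in_set2 => /and3P[].
apply/idP/andP => [fF|[fA fA']].
  have [fA fA'] : {in A, forall x, f x \in A} /\ {in ~: A, forall x, f x \in ~: A}.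
    split=> x xA; have [->//|fx] := eqVneq (f x) x;
      have := spl _ (orients_moved fF fx); rewrite !subUset !sub1set;
      rewrite !inE in xA *; case=> /andP[] //; by rewrite ?xA // (negPf xA).
  have [fE ff] := orientsP _ _ fF.
  have main (B : {set 'I_n}) : {in B, forall x, f x \in B} ->
      orients (restrict f B) (edges_in F B).
    move=> fB; apply/orientsP; split; first by rewrite arcs_restrict // fE.
    move=> x; rewrite moved_restrict inE => /andP[xf xB].
    by rewrite !ffunE xB fB // ff.
  by split; apply: main.
have [cA cA'] := (closed_restrict _ fA, closed_restrict _ fA').
move: fA fA' => /orientsP[]; rewrite arcs_restrict // => EA NA.
move=> /orientsP[]; rewrite arcs_restrict // => EA' NA'.
have splf : edges_split (arcs f) A.
  move=> _ /imsetP[x _ ->]; rewrite !subUset !sub1set !inE.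
  case: (boolP (x \in A)) => xA; [left | right].
    by rewrite cA.
  by have := cA' x; rewrite !inE; apply.
apply/orientsP; split.
  apply/setP => e; move/setP/(_ e): EA; move/setP/(_ e): EA'; rewrite !inE.
  move=> EA'e EAe; apply/idP/idP => eF.
    by case: (splf e eF) => sub; move: EAe EA'e; rewrite sub eF !andbT // => <-.
  by case: (spl e eF) => sub; move: EAe EA'e; rewrite sub eF !andbT // => ->.
move=> x xf; case: (boolP (x \in A)) => xA.
  by have := NA x; rewrite moved_restrict inE xf xA !ffunE xA cA // => ->.
have xA' : x \in ~: A by rewrite inE.
by have := NA' x; rewrite moved_restrict inE xf xA' !ffunE xA' cA' // => ->.
Qed.

Section Ring.

Variables (R : comNzRingType) (a : 'I_n -> 'I_n -> R).

(** Up to the edge weights and a sign, the coefficient contributed by the edge set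
    [F] to the characteristic polynomial. *)
Definition orientation_sum F : R :=
  \sum_(f : {ffun 'I_n -> 'I_n} | orients f F) \det (fun_mx a f).

(** Orienting [F] amounts to orienting independently the edges inside [A] and those
    outside, and [fun_mx] factors accordingly. *)
Lemma orientation_sum_split F A : edges_split F A ->
  orientation_sum F =
  orientation_sum (edges_in F A) * orientation_sum (edges_in F (~: A)).
Proof.
move=> spl; rewrite /orientation_sum big_distrlr [RHS]pair_big /=.
rewrite [RHS](reindex_onto
  (fun f : {ffun 'I_n -> 'I_n} => (restrict f A, restrict f (~: A)))
  (fun p => [ffun i => if i \in A then p.1 i else p.2 i])) /=; last first.
  move=> [g h] /= /andP[/subset_orients gA /subset_orients hA].
  have fixed (B : {set 'I_n}) (k : 'I_n -> 'I_n) :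
      moved k \subset B -> forall i, i \notin B -> k i = i.
    by move=> kB i; apply: contraNeq => ki; rewrite (subsetP kB) ?inE.
  congr (_, _); apply/ffunP => i; rewrite !ffunE ?inE; case: (boolP (i \in A)) => //= iA.
    by rewrite (fixed _ _ gA).
  by rewrite (fixed _ _ hA) // inE iA.
apply: eq_big => f; last first.
  move=> fF; apply: det_fun_mx_split => x xA; have [->//|fx] := eqVneq (f x) x.
  have := spl _ (orients_moved fF fx); rewrite !subUset !sub1set !inE xA.
  by case=> // /andP[].
rewrite (orients_split f spl) -[LHS]andbT; congr (_ && _); apply/esym/eqP/ffunP => i.
by rewrite !ffunE inE; case: ifP => // ->.
Qed.

Lemma orientation_sum0 : orientation_sum set0 = 1.
Proof.
rewrite /orientation_sum (big_pred1 (finfun id)) => [|f].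
  by apply: (@det_fun_mx_acyclic _ _ _ _ (fun=> 0%N)) => i; rewrite ffunE eqxx.
apply/orientsP/eqP => [[f0 _]|->]; last first.
  have m0 : moved (finfun id : {ffun 'I_n -> 'I_n}) = set0.
    by apply/setP => i; rewrite !inE ffunE eqxx.
  by rewrite /arcs m0 imset0; split=> // i; rewrite inE.
apply/ffunP => i; rewrite ffunE; apply/eqP; apply: contraT => fi.
have : [set i; f i] \in arcs f by rewrite mem_arcs ?inE.
by rewrite f0 inE.
Qed.

Lemma orientation_sum_components F : simple_graph F ->
  orientation_sum F = \prod_(C in components F) orientation_sum (edges_in F C).
Proof.
move=> simpleF; have /and3P[/eqP cov tI _] := components_partition F.
have {1}-> : F = edges_in F (\bigcup_(C <- enum (components F)) C).
  apply/setP => e; rewrite big_enum /= -/(cover _) cov inE subsetT andbT //.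
rewrite -big_enum /=; have := enum_uniq (components F).
have : {subset enum (components F) <= components F} by move=> C; rewrite mem_enum.
elim: (enum _) => [|C r IH] sub /=.
  move=> _; rewrite !big_nil -orientation_sum0; congr orientation_sum.
  apply/setP => e; rewrite !inE; apply/negP => /andP[/(forall_inP simpleF)].
  by rewrite subset0 => /eqP e2 /eqP e0; rewrite e0 cards0 in e2.
case/andP=> Cr ur; rewrite !big_cons; set U := \bigcup_(_ <- _) _.
have CF : C \in components F by apply: sub; rewrite mem_head.
have CU : [disjoint U & C].
  rewrite /U bigcup_seq disjoint_sym; apply: bigcup_disjoint => B Br.
  apply: (trivIsetP tI) => //; first by apply: sub; rewrite inE Br orbT.
  by apply: contraNneq Cr => ->.
rewrite (@orientation_sum_split _ C) => [|e]; last first.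
  by rewrite inE => /andP[/(simple_edge_component simpleF CF)].
rewrite -IH // => [|B Br]; last by apply: sub; rewrite inE Br orbT.
congr (orientation_sum _ * orientation_sum _); apply/setP => e; rewrite !inE.
  rewrite -andbA; congr (_ && _); apply: andb_idl => eC.
  exact: subset_trans eC (subsetUl _ _).
rewrite -andbA; congr (_ && _); rewrite -subsetI setIUl setICr set0U.
by rewrite (setIidPl _) // -disjoints_subset.
Qed.

(** There are more edges than vertices to be their tails. *)
Lemma orientation_sum_overfull F C : (#|C| < #|edges_in F C|)%N ->
  orientation_sum (edges_in F C) = 0.
Proof.
move=> lt; rewrite /orientation_sum big_pred0 // => f; apply: contraTF lt => fF.
by rewrite -leqNgt (orients_card fF) subset_leq_card // (subset_orients fF).
Qed.

Lemma orients_full f F C : arcs f \subset edges_in F C ->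
  (forall i, i \in moved f -> f (f i) != i) -> #|moved f| = #|edges_in F C| ->
  orients f (edges_in F C).
Proof.
move=> fF ff E; apply/orientsP; split=> //; apply/eqP.
by rewrite eqEcard fF card_arcs // E leqnn.
Qed.

(** An orientation of a tree leaves exactly one vertex unmoved, and each choice of
    this root is realised by exactly one orientation, the flow towards the root;
    its determinant is 1. *)
Lemma orientation_sum_tree F C : connected_on F C -> #|C| = #|edges_in F C|.+1 ->
  orientation_sum (edges_in F C) = #|C|%:R.
Proof.
move=> conn card_C; set E := edges_in F C.
have rooted r : r \in C -> exists g : {ffun 'I_n -> 'I_n},
    \det (fun_mx a g) = 1 /\
    forall f : {ffun 'I_n -> 'I_n}, orients f E && (f r == r) = (f == g).
  move=> rC; have [g [d [gM gd gF gg]]] := spanning_tree conn rC.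
  exists g; split; first by apply: (@det_fun_mx_acyclic _ _ _ _ d) => i gi; apply: gd; rewrite inE.
  have card_Cr : #|C :\ r| = #|E| by apply/eqP; rewrite -eqSS -card_C (cardsD1 r C) rC.
  have gE : orients g E by apply: orients_full => //; rewrite gM.
  have gr : g r = r by apply/eqP; have := in_setD1 r C r; rewrite -gM inE eqxx => /negbFE.
  move=> f; apply/andP/eqP => [[fE /eqP fr]|-> //]; last by rewrite gr.
  apply/ffunP/(@orients_unique _ _ _ _ [set r] d fE gE).
  - apply/eqP; rewrite eqEcard gM card_Cr (orients_card fE) leqnn andbT subsetD1.
    by rewrite (subset_orients fE) inE fr eqxx.
  - by move=> x /set1P ->; rewrite fr gr.
  - by move=> x _; apply: gd.
transitivity (\sum_(f : {ffun 'I_n -> 'I_n} | orients f E)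
    \sum_(r in C | f r == r) \det (fun_mx a f)).
  apply: eq_bigr => f fE.
  have /cards1P[r rE] : #|C :\: moved f| == 1%N.
    rewrite cardsD (setIidPr (subset_orients fE)) -(orients_card fE) card_C.
    by rewrite subSnn.
  rewrite (big_pred1 r) // => i; move/setP/(_ i): rE.
  by rewrite !inE negbK andbC.
rewrite (exchange_big_dep (mem C)) => [|f r _ /andP[]] //=.
rewrite -sumr_const; apply: eq_bigr => r rC.
have [g [g1 fg]] := rooted r rC.
by rewrite (big_pred1 g) // => f; rewrite rC fg.
Qed.

Lemma det_cycle_orientation F C s (g : {ffun 'I_n -> 'I_n}) (d : 'I_n -> nat) :
  cycle_in F C s -> {in s, g =1 next s} ->
  (forall x, x \in C -> x \notin s -> (d (g x) < d x)%N) -> moved g = C ->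
  \det (fun_mx a g) = 1 - \prod_(p <- s) a p (next s p).
Proof.
move=> /and3P[size_s /andP[_ us] _] gs gd gM.
rewrite (@det_fun_mx_split _ _ _ _ [set x in s]) => [|i]; last first.
  by rewrite !inE => si; rewrite gs // mem_next.
rewrite [X in _ * X](@det_fun_mx_acyclic _ _ _ _ d) => [|i]; last first.
  rewrite ffunE !inE; case: ifP => [si gi|]; last by rewrite eqxx.
  by apply: gd; rewrite // -gM inE.
rewrite mulr1 -det_fun_mx_next //; last exact: ltnW.
congr (\det _); apply: eq_fun_mx => i; rewrite ffunE inE.
by case: ifP => [/gs|/negbT/next_id].
Qed.

End Ring.

Lemma cycle_in_rev F C s : cycle_in F C s -> cycle_in F C (rev s).
Proof.
move=> /and3P[size_s /andP[cyc us] sC]; apply/and3P; rewrite size_rev all_rev.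
split=> //; apply/andP; rewrite rev_uniq; split=> //; rewrite rev_cycle.
by apply: sub_cycle cyc => x y; rewrite /adj /= setUC.
Qed.

(** If [f] disagrees with [g] somewhere then it already disagrees on the cycle, since
    [g] flows there; the disagreement propagates around the cycle, so [f] runs the
    cycle backwards like [h], and then coincides with [h] everywhere. *)
Lemma cycle_orientation_or_rev F C s (f g h : {ffun 'I_n -> 'I_n}) (d d' : 'I_n -> nat) :
  cycle_in F C s -> orients f (edges_in F C) -> orients g (edges_in F C) ->
  orients h (edges_in F C) ->
  moved f = C -> moved g = C -> moved h = C ->
  {in s, g =1 next s} -> {in s, h =1 prev s} ->
  (forall x, x \in C -> x \notin s -> (d (g x) < d x)%N) ->
  (forall x, x \in C -> x \notin s -> (d' (h x) < d' x)%N) ->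
  f = g \/ f = h.
Proof.
move=> /and3P[size_s /andP[cyc us] sC] fE gE hE fM gM hM gs hs gd hd.
have [/forall_inP agree|] := boolP [forall x in [set x in s], f x == g x].
  left; apply/ffunP/(orients_unique (S := [set x in s]) (d := d) fE gE).
  - by rewrite fM gM.
  - by move=> x /agree/eqP.
  - by move=> x; rewrite inE gM => xs xC; apply: gd.
rewrite negb_forall_in => /exists_inP[x]; rewrite inE => xs fgx; right.
have step y : y \in s -> g y != f y -> f (next s y) = y /\ g (next s y) != f (next s y).
  move=> ys gfy; have := orients_disagree gE fE _ gfy.
  by rewrite (gs _ ys); apply; rewrite fM gM.
have all_s y : y \in s -> g y != f y.
  move=> ys; apply: (@next_transitive _ _ (fun z => g z != f z) x y us xs ys).
    by rewrite eq_sym.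
  by move=> z zs /(step z zs)[].
apply/ffunP/(orients_unique (S := [set x in s]) (d := d') fE hE).
- by rewrite fM hM.
- move=> y; rewrite inE => ys; rewrite hs // -{1}(next_prev us y).
  have ps : prev s y \in s by rewrite mem_prev.
  by have [] := step _ ps (all_s _ ps).
- by move=> y; rewrite inE hM => ys yC; apply: hd.
Qed.

Lemma prod_next_rev (R : comNzRingType) (a : 'I_n -> 'I_n -> R) s : uniq s ->
  \prod_(p <- rev s) a p (next (rev s) p) = \prod_(p <- s) a (next s p) p.
Proof.
move=> us; rewrite big_uniq ?rev_uniq // big_uniq //=.
rewrite (reindex_inj (can_inj (prev_next us))) /=.
apply: eq_big => p; first by rewrite mem_rev mem_next.
by rewrite next_rev // prev_next.
Qed.

(** The only two orientations run the cycle in one direction or the other, and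
    contribute [1 - w] and [1 - 1 / w]; the sum of these equals their product. *)
Lemma orientation_sum_cycle (R : fieldType) (a : 'I_n -> 'I_n -> R) F C s :
  (forall i j, i != j -> a i j != 0) -> (forall i j, i != j -> a j i = (a i j)^-1) ->
  connected_on F C -> #|edges_in F C| = #|C| -> cycle_in F C s ->
  orientation_sum a (edges_in F C) =
  (1 - \prod_(p <- s) a p (next s p)) * (1 - 1 / \prod_(p <- s) a p (next s p)).
Proof.
move=> a0 aV conn card_E cyc; set E := edges_in F C; set w := \prod_(p <- s) _.
have /and3P[size_s /andP[_ us] _] := cyc.
have size_s' := ltnW size_s.
have cyc' := cycle_in_rev cyc.
have wV : \prod_(p <- rev s) a p (next (rev s) p) = w^-1.
  rewrite prod_next_rev // -prodfV big_seq [RHS]big_seq.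
  by apply: eq_bigr => p ps; rewrite aV // eq_sym next_neq.
have w0 : w != 0.
  rewrite prodf_seq_neq0; apply/allP => p ps /=.
  by rewrite a0 // eq_sym next_neq.
have [g [d [gs gd gM gF gg]]] := cycle_orientation conn cyc.
have [h [d' [hs hd hM hF hh]]] := cycle_orientation conn cyc'.
have gE : orients g E by apply: orients_full => //; rewrite gM.
have hE : orients h E by apply: orients_full => //; rewrite hM.
have hs' : {in s, h =1 prev s} by move=> x xs; rewrite hs ?mem_rev // next_rev.
have hd' x : x \in C -> x \notin s -> (d' (h x) < d' x)%N.
  by move=> xC xs; apply: hd; rewrite ?mem_rev.
have gh : g != h.
  have [x xs] : exists x, x \in s.
    by case: (s) size_s => // x t _; exists x; rewrite mem_head.
  apply: contraTneq (next_next_neq us size_s xs) => gh.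
  by rewrite negbK -{2}(next_prev us x) -hs' // -gh gs // eqxx.
rewrite /orientation_sum (bigD1 g) //= (bigD1 h) /=; last by rewrite hE eq_sym.
rewrite big1 => [|f /andP[/andP[fE fg] fh]]; last first.
  have fM : moved f = C.
    by apply/eqP; rewrite eqEcard (subset_orients fE) -(orients_card fE) card_E /=.
  have [fE'|fE'] := cycle_orientation_or_rev cyc fE gE hE fM gM hM gs hs' gd hd'.
    by rewrite fE' eqxx in fg.
  by rewrite fE' eqxx in fh.
rewrite (det_cycle_orientation _ cyc gs gd gM) (det_cycle_orientation _ cyc' hs hd hM).
by rewrite wV -/w; field.
Qed.

End OrientationSum.

(** * The characteristic polynomial *)

Section MixedForests.

Variable n : nat.
Implicit Types (F : {set {set 'I_n}}) (C : {set 'I_n}).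

Lemma card_edges_components F : simple_graph F ->
  #|F| = (\sum_(C in components F) #|edges_in F C|)%N.
Proof.
move=> simpleF; have /and3P[/eqP cov tI _] := components_partition F.
under eq_bigr => C CF do rewrite -sum1_card; rewrite -sum1_card.
have -> : (\sum_(C in components F) \sum_(e in edges_in F C) 1 =
  \sum_(C in components F) \sum_(e in F | e \subset C) 1)%N.
  by apply: eq_bigr => C _; apply: eq_bigl => e; rewrite inE.
rewrite (exchange_big_dep (mem F)) /= => [|C e _ /andP[]] //.
apply: eq_bigr => e eF; have /cards2P[x [y [_ eE]]] := forall_inP simpleF e eF.
have xcov : x \in cover (components F) by rewrite cov inE.
rewrite (big_pred1 (pblock (components F) x)) // => C.
rewrite eF /=; apply/andP/eqP => [[CF eC]|->].
  by apply/esym/def_pblock => //; apply: (subsetP eC); rewrite eE set21.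
have CF := pblock_mem xcov; split=> //.
have [//|] := simple_edge_component simpleF CF eF.
by rewrite eE subUset !sub1set !inE mem_pblock xcov.
Qed.

Lemma mixed_forest_component F C : mixed_forest F -> C \in components F ->
  #|C| = (#|edges_in F C| + is_tree F C)%N.
Proof.
case/andP=> simpleF /forall_inP mF CF; have := mF C CF.
case: (boolP (is_tree F C)) => tC; last by move=> /eqP <-; rewrite addn0.
by move=> _; move: tC; rewrite is_treeE // => /eqP ->; rewrite addn1.
Qed.

Lemma one_cycleE F C : mixed_forest F -> C \in components F ->
  is_one_cycle F C = ~~ is_tree F C.
Proof.
move=> mF CF; rewrite /is_one_cycle (mixed_forest_component mF CF) -{1}[#|_|]addn0.
by rewrite eqn_add2l; case: is_tree.
Qed.

Lemma mixed_forest_card F : mixed_forest F ->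
  (#|F| + #|tree_components F|)%N = n.
Proof.
move=> mF; have simpleF : simple_graph F by case/andP: mF.
rewrite -[RHS]card_ord -cardsT (card_partition (components_partition F)).
rewrite card_edges_components //.
under [RHS]eq_bigr => C CF do rewrite (mixed_forest_component mF CF).
rewrite big_split /=; congr (_ + _)%N.
rewrite -sum1_card big_mkcond [RHS]big_mkcond; apply: eq_bigr => C _; rewrite inE.
by case: (C \in _) => //; case: is_tree.
Qed.

Section Weights.

Variables (R : realFieldType) (c phi : 'I_n -> 'I_n -> R).
Hypotheses (c_sym : forall i j, i != j -> c i j = c j i)
  (phi_neq0 : forall i j, i != j -> phi i j != 0)
  (phi_inv : forall i j, i != j -> phi j i = (phi i j)^-1).

Lemma orientation_sum_mixed_forest F (w : {set 'I_n} -> R) : mixed_forest F ->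
  (forall C, C \in one_cycle_components F ->
     exists2 s, cycle_in F C s & w C = holonomy phi s) ->
  orientation_sum phi F =
  \prod_(C in tree_components F) (#|edges_in F C| + 1)%:R *
  \prod_(C in one_cycle_components F) ((1 - w C) * (1 - 1 / w C)).
Proof.
move=> mF wF; have simpleF : simple_graph F by case/andP: mF.
rewrite orientation_sum_components // (bigID (is_tree F)) /=.
congr (_ * _); apply: eq_big => C; rewrite ?inE //.
  move=> /andP[CF tC]; have conn := component_connected CF.
  have := mixed_forest_component mF CF; rewrite tC => /esym card_C.
  by rewrite orientation_sum_tree ?card_C // -card_C addn1.
  by apply: andb_id2l => CF; rewrite one_cycleE.
move=> /andP[CF tC]; have conn := component_connected CF.
have := mixed_forest_component mF CF; rewrite (negPf tC) addn0 => /esym card_C.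
have [|s cyc ->] := wF C; first by rewrite inE CF one_cycleE.
exact: orientation_sum_cycle.
Qed.

(** A component that is neither a tree nor has as many edges as vertices has too many
    edges to be oriented. *)
Lemma orientation_sum_not_mixed_forest F : simple_graph F -> ~~ mixed_forest F ->
  orientation_sum phi F = 0.
Proof.
move=> simpleF; rewrite /mixed_forest simpleF negb_forall_in => /exists_inP[C CF].
rewrite negb_or is_treeE // => /andP[nt nc].
rewrite orientation_sum_components // (bigD1 C) //= orientation_sum_overfull ?mul0r //.
have := card_spanning_tree (component_neq0 CF) (component_connected CF).
by move: nt nc; rewrite /is_one_cycle; lia.
Qed.

Definition edge_weight F : R :=
  \prod_(p < n) \prod_(q < n | (p < q)%N && ([set p; q] \in F)) c p q.

(** Both sides are products over the edges of [F], read off once from the tail of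
    each edge and once from its smaller endpoint. *)
Lemma edge_weight_orientation f F : orients f F ->
  \prod_(i in moved f) c i (f i) = edge_weight F.
Proof.
move=> /orientsP[fF ff].
pose wt (e : {set 'I_n}) :=
  \prod_(p < n) \prod_(q < n | (p < q)%N && ([set p; q] == e)) c p q.
have wtE i j : i != j -> wt [set i; j] = c i j.
  wlog ij : i j / (i < j)%N => [lt|] ne.
    case: (ltngtP i j) => [ij|ji|/val_inj ij]; [exact: lt | | by rewrite ij eqxx in ne].
    by rewrite setUC lt 1?eq_sym // c_sym // eq_sym.
  rewrite /wt (bigD1 i) //= [X in _ * X]big1 => [|p pi]; last first.
    apply: big_pred0 => q; apply/andP => -[pq /eqP/eq_set2[]] [] pE qE.
      by rewrite pE eqxx in pi.
    by move: pq; rewrite pE qE ltnNge ltnW.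
  rewrite mulr1 (big_pred1 j) // => q; apply/andP/eqP => [[iq]|->].
    case/eqP/eq_set2 => -[] // iE qE.
    by rewrite iE eqxx in ne.
  by rewrite ij eqxx.
transitivity (\prod_(e in F) wt e).
  rewrite -fF /arcs big_imset /=; last exact: arc_inj.
  by apply: eq_bigr => i; rewrite inE => fi; rewrite wtE // eq_sym.
rewrite /wt exchange_big; apply: eq_bigr => p _ /=.
rewrite (exchange_big_dep (fun q : 'I_n => (p < q)%N && ([set p; q] \in F))) /=.
  apply: eq_bigr => q /andP[pq pqF]; rewrite (big_pred1 [set p; q]) // => e.
  by rewrite pq /= eq_sym; case: eqP => [->|]; rewrite ?pqF ?andbF.
by move=> e q eF /andP[-> /eqP ->].
Qed.

Lemma laplacian_vertex_form (v : 'rV[R]_n) :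
  laplacian c phi v =
  \sum_(i < n) (\sum_(j < n | j != i) c i j * (v 0 i - phi j i * v 0 j)) *: u R i.
Proof.
pose t i j : 'rV[R]_n := (c i j * (v 0 i - phi j i * v 0 j)) *: u R i.
transitivity (\sum_(i < n) \sum_(j < n | (i < j)%N) t i j +
              \sum_(i < n) \sum_(j < n | (j < i)%N) t i j).
  rewrite [X in _ + X](exchange_big_dep predT) //= -big_split; apply: eq_bigr => i _ /=.
  rewrite -big_split; apply: eq_bigr => j ij /=.
  have ne : i != j by apply: contraTneq ij => ->; rewrite ltnn.
  rewrite /t scalerBr scalerA -scaleNr; congr (_ + _ *: _).
  rewrite -(c_sym ne) (phi_inv ne).
  by have := phi_neq0 ne => p0; field.
rewrite -big_split; apply: eq_bigr => i _ /=; rewrite scaler_suml.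
rewrite [RHS](bigID (fun j : 'I_n => (i < j)%N)) /=.
by congr (_ + _); apply: eq_bigl => j; rewrite -(inj_eq val_inj) /=; case: ltngtP.
Qed.

Lemma laplacian_mx i k :
  lin1_mx (laplacian c phi) i k =
  \sum_(j < n | j != i) c i j * ((i == k)%:R - phi i j * (j == k)%:R).
Proof.
rewrite mxE /= laplacian_vertex_form summxE (bigD1 k) //= [X in _ + X]big1 => [|l lk]; last first.
  by rewrite !mxE [k == l]eq_sym (negPf lk) andbF mulr0.
rewrite !mxE !eqxx mulr1 addr0.
under eq_bigr => j _ do rewrite !mxE /=.
have [->|ik] := eqVneq i k.
  apply: eq_bigr => j jk.
  by rewrite (negPf jk) !mulr0.
rewrite (bigD1 i) //= [RHS](bigD1 k) 1?eq_sym //= !eqxx.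
rewrite !big1 => [|j /andP[ji jk]|j /andP[ji jk]].
- by rewrite (c_sym ik).
- by rewrite (negPf jk) mulr0 subr0 mulr0.
- by rewrite (negPf jk) mulr0 subr0 mulr0.
Qed.

(** In row [i] of [t - M] each vertex either takes the term [t e_i], encoded as
    [f i = i], or chooses a neighbour [j = f i] and takes the term
    [- c_ij (e_i - phi_ij e_j)]. *)
Lemma char_poly_laplacian :
  char_poly (lin1_mx (laplacian c phi)) =
  \sum_(f : {ffun 'I_n -> 'I_n})
    ((-1) ^+ #|moved f| * \prod_(i in moved f) c i (f i) *
      \det (fun_mx phi f)) *: 'X^(n - #|moved f|).
Proof.
pose r (f : {ffun 'I_n -> 'I_n}) i : {poly R} :=
  if f i == i then 'X else - (c i (f i))%:P.
pose B i j k : {poly R} :=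
  (if j == i then 'X * (i == k)%:R
   else - (c i j)%:P * ((i == k)%:R - phi i j * (j == k)%:R)%:P).
have -> : char_poly (lin1_mx (laplacian c phi)) =
    \det (\matrix_(i, k) \sum_j B i j k).
  congr (\det _); apply/matrixP => i k; rewrite !mxE.
  move: (laplacian_mx i k); rewrite mxE => ->; rewrite [RHS](bigD1 i) //= /B eqxx rmorph_sum.
  rewrite -sumrN /= mulr_natr; congr (_ + _); apply: eq_bigr => j /negPf ->.
  by rewrite rmorphM mulNr.
rewrite det_row_sum; apply: eq_bigr => f _.
have -> : \matrix_(i, k) B i (f i) k =
    \matrix_(i, k) (r f i * map_mx polyC (fun_mx phi f) i k).
  apply/matrixP => i k; rewrite !mxE /B /r.
  by case: eqVneq => [|fi] /=; rewrite ?mul0r ?subr0 ?mul1r ?rmorph_nat.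
have -> : 'X^(n - #|moved f|) = \prod_(i in ~: moved f) r f i.
  have <- : #|~: moved f| = (n - #|moved f|)%N.
    by rewrite cardsCs setCK card_ord.
  by rewrite -prodr_const; apply: eq_bigr => i; rewrite !inE negbK /r => ->.
have -> : (-1) ^+ #|moved f| * \prod_(i in moved f) c i (f i) =
    \prod_(i in moved f) (- c i (f i)).
  by rewrite prodrN.
rewrite det_scale_rows det_map_mx /= -mul_polyC rmorphM rmorph_prod /= mulrAC.
congr (_ * _); rewrite (bigID (mem (moved f))) /=; congr (_ * _).
  by apply: eq_bigr => i; rewrite inE /r rmorphN => /negPf ->.
by apply: eq_bigl => i; rewrite !inE.
Qed.

(** Going along an edge and back has trivial holonomy, so the factor [1 - w] of this
    2-cycle is zero. *)
Lemma det_fun_mx_two_cycle (f : 'I_n -> 'I_n) i : f i != i -> f (f i) = i ->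
  \det (fun_mx phi f) = 0.
Proof.
move=> fi ffi; pose s := [:: i; f i].
have us : uniq s by rewrite /= inE eq_sym fi.
have fs : {in s, f =1 next s}.
  move=> x; rewrite !inE => /orP[] /eqP ->; rewrite /= ?eqxx //.
  by rewrite ffi (negPf fi).
rewrite (@det_fun_mx_split _ _ _ _ [set x in s]) => [|x]; last first.
  by rewrite !inE => /orP[] /eqP ->; rewrite ?ffi eqxx ?orbT.
rewrite (_ : fun_mx phi (restrict f [set x in s]) = fun_mx phi (next s)).
  rewrite det_fun_mx_next // !big_cons big_nil -!fs ?inE ?eqxx ?orbT // ffi.
  rewrite (phi_inv (_ : i != f i)) 1?eq_sym // mulr1 mulfV ?subrr ?mul0r //.
  by rewrite phi_neq0 // eq_sym.
apply: eq_fun_mx => x; rewrite ffunE inE.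
by case: ifP => [/fs|/negbT/next_id].
Qed.

Lemma char_poly_mixed_forests (w : {set {set 'I_n}} -> {set 'I_n} -> R) :
  (forall F C, mixed_forest F -> C \in one_cycle_components F ->
     exists2 s, cycle_in F C s & w F C = holonomy phi s) ->
  char_poly (lin1_mx (laplacian c phi)) =
  \sum_(k < n.+1) ((-1) ^+ k * mu c w k) *: 'X^(n - k).
Proof.
move=> hw; rewrite char_poly_laplacian.
pose T F : {poly R} :=
  ((-1) ^+ #|F| * edge_weight F * orientation_sum phi F) *: 'X^(n - #|F|).
pose nobacktrack (f : {ffun 'I_n -> 'I_n}) := [forall i in moved f, f (f i) != i].
transitivity (\sum_(F : {set {set 'I_n}}) T F).
  (* choices going back and forth along an edge contribute nothing; the others
     orient the set of edges they use *)
  rewrite (bigID nobacktrack) /= [X in _ + X]big1 ?addr0 => [|f]; last first.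
    rewrite negb_forall_in => /exists_inP[i]; rewrite inE negbK => fi /eqP ffi.
    by rewrite (det_fun_mx_two_cycle fi ffi) mulr0 scale0r.
  rewrite (partition_big (fun f : {ffun 'I_n -> 'I_n} => arcs f) predT) //=.
  apply: eq_bigr => F _; rewrite /T /orientation_sum big_distrr scaler_suml /=.
  apply: eq_big => f; first by rewrite andbC.
  rewrite andbC => fF.
  by rewrite (orients_card fF) (edge_weight_orientation fF).
rewrite (bigID (@mixed_forest n)) /= [X in _ + X]big1 ?addr0 => [|F nF]; last first.
  rewrite /T; case: (boolP (simple_graph F)) => [simpleF|nsF].
    by rewrite orientation_sum_not_mixed_forest // mulr0 scale0r.
  rewrite /orientation_sum big_pred0 ?mulr0 ?scale0r // => f.
  apply: contraNF nsF => /orientsP[<- _]; apply/forall_inP => _ /imsetP[i + ->].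
  by rewrite inE cards2 eq_sym => ->.
have leF F : mixed_forest F -> (#|F| < n.+1)%N.
  by move=> /mixed_forest_card; lia.
rewrite (partition_big (fun F => inord #|F| : 'I_n.+1) predT) //=.
apply: eq_bigr => k _; rewrite /mu big_distrr scaler_suml /=.
apply: eq_big => F.
  apply: andb_id2l => mF; rewrite -(inj_eq val_inj) /= inordK //; exact: leF.
case/andP=> mF; rewrite -(inj_eq val_inj) /= inordK ?leF // => /eqP Fk.
rewrite /T Fk (@orientation_sum_mixed_forest F (w F)) // => [|C]; last exact: hw.
by rewrite !mulrA.
Qed.

End Weights.

End MixedForests.

Theorem theorem2 (R : realFieldType) (n : nat) (c phi : 'I_n -> 'I_n -> R)
    (n_ge1 : (1 <= n)%N)
    (c_sym : forall i j, i != j -> c i j = c j i)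
    (phi_neq0 : forall i j, i != j -> phi i j != 0)
    (phi_inv : forall i j, i != j -> phi j i = (phi i j)^-1) :
  [/\ (* the second expression for the Laplacian *)
      forall v : 'rV[R]_n,
        laplacian c phi v =
        \sum_(i < n) (\sum_(j < n | j != i) c i j * (v 0 i - phi j i * v 0 j))
          *: u R i,
      (* a mixed forest with k edges has n - k tree components *)
      forall F : {set {set 'I_n}}, mixed_forest F ->
        (#|F| <= n)%N /\ #|tree_components F| = (n - #|F|)%N,
      (* each one-cycle component has a cycle, so its holonomy makes sense *)
      forall (F : {set {set 'I_n}}) (C : {set 'I_n}), mixed_forest F ->
        C \in one_cycle_components F -> exists s, cycle_in F C s
    & (* the formula, whichever way the cycles are traversed *)
      forall w : {set {set 'I_n}} -> {set 'I_n} -> R,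
        (forall (F : {set {set 'I_n}}) (C : {set 'I_n}), mixed_forest F ->
           C \in one_cycle_components F ->
           exists2 s, cycle_in F C s & w F C = holonomy phi s) ->
        char_poly (lin1_mx (laplacian c phi)) =
        \sum_(k < n.+1) ((-1) ^+ k * mu c w k) *: 'X^(n - k)].
Proof.
split.
- exact: laplacian_vertex_form.
- by move=> F /mixed_forest_card; lia.
- move=> F C mF; rewrite inE => /andP[CF /eqP card_C].
  by apply: cycle_exists; rewrite ?card_C //; case/andP: mF.
- by move=> w hw; apply: char_poly_mixed_forests.
Qed.
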